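(* Let $I$ be a set and let $R,S\subseteq I\times I$. Then $M_{R\circ S}=M_R\odot M_S$.
   Context: For a set $I$ (possibly infinite), an $I\times I$-matrix $[a_{ij}]$ over $\{0,1\}$ is a mapping $(i,j)\mapsto a_{ij}$ from $I\times I$ to $\{0,1\}$. The incidence matrix of $R\subseteq I\times I$ is the $I\times I$-matrix $M_R=[a_{ij}]$ over $\{0,1\}$ with $a_{ij}=1$ if $(i,j)\in R$ and $a_{ij}=0$ otherwise. The composition of relations is $R\circ S=\{(x,y)\in I\times I\mid \text{there exists } z\in I \text{ with } (x,z)\in R \text{ and } (z,y)\in S\}$. For $I\times I$-matrices $A=[a_{ij}]$ and $B=[b_{ij}]$ over $\{0,1\}$, $A\odot B$ is the $I\times I$-matrix $[c_{ij}]$ over $\{0,1\}$ with $c_{ij}:=\max_{k\in I}a_{ik}b_{kj}$ for all $i,j\in I$. *)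

(* Defs.v *)
From mathcomp Require Import all_boot all_order all_algebra.
From mathcomp Require Import boolp classical_sets.

Set Implicit Arguments.
Unset Strict Implicit.
Unset Printing Implicit Defensive.

Import Order.TTheory GRing.Theory.
Local Open Scope classical_set_scope.
Local Open Scope ring_scope.

(* 'I_2 is {0, 1} with 0 < 1. Its ring product is multiplication modulo 2,
   which on {0, 1} is the product of integers. *)
Definition bin_matrix (I : Type) := I * I -> 'I_2.

Definition incidence (I : Type) (R : set (I * I)) : bin_matrix I :=
  fun p => if p \in R then 1 else 0.

(* The library's [\;] takes the relation applied first on its right:
   [(x, y)] is in [S \; R] when [R (x, z)] and [S (z, y)] for some [z]. *)
Definition rel_comp (I : Type) (R S : set (I * I)) : set (I * I) :=
  (S \; R)%relation.

(* The greatest element of [A], which must belong to [A]; [x0] is returned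
   when there is none. *)
Definition set_max d (T : orderType d) (x0 : T) (A : set T) : T :=
  xget x0 (A `&` ubound A).

(* Once an entry [(i, j)] is given, [I] is inhabited, so the maximum is over a
   nonempty subset of {0, 1}; it exists and the default 0 plays no role. *)
Definition odot (I : Type) (A B : bin_matrix I) : bin_matrix I :=
  fun '(i, j) => set_max (0 : 'I_2) [set A (i, k) * B (k, j) | k in [set: I]].

(* Main.v *)
Require Import Defs.
From mathcomp Require Import all_boot all_order all_algebra.
From mathcomp Require Import boolp classical_sets.

Import Order.TTheory.
Local Open Scope classical_set_scope.

(** A product of two incidence entries is 1 exactly when [k] links [i] to [j]. So the entry of
    [rel_comp R S] at [(i, j)] is both attained by some product and an upper bound of them all, and
    [set_max_unique] identifies it with the maximum. *)

Lemma set_max_unique d (T : orderType d) (x0 m : T) (A : set T) :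
  A m -> ubound A m -> set_max x0 A = m.
Proof.
move=> Am ubm; apply: xget_unique => // x [Ax ubx].
by apply/eqP; rewrite eq_le ubm // ubx.
Qed.

Lemma incidence_mul (I : Type) (R S : set (I * I)) (i j k : I) :
  (incidence R (i, k) * incidence S (k, j))%R =
  if ((i, k) \in R) && ((k, j) \in S) then 1%R else 0%R.
Proof. by rewrite /incidence; do 2 case: ifP => _; apply/val_inj. Qed.

Theorem proposition1 (I : Type) (R S : set (I * I)) :
  incidence (rel_comp R S) = odot (incidence R) (incidence S).
Proof.
apply/funext => -[i j]; apply/esym/set_max_unique;
  rewrite [incidence (rel_comp R S) _]/incidence.
- case: ifPn => [|/negP nRS].
    by rewrite inE => -[k Rik Skj]; exists k; rewrite // incidence_mul !mem_set.
  (* With no linking element every product is 0, so any index attains it; [i] is one at hand. *)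
  exists i => //; rewrite incidence_mul; case: ifP => // /andP[].
  by rewrite !inE => Rii Sij; case: nRS; rewrite inE; exists i.
(* A product 1 makes [k] a link, which forces the entry to be 1; a product 0 is below either
   value. *)
- move=> _ [k _ <-]; rewrite incidence_mul; case: ifP => [/andP[]|_].
    by rewrite !inE => Rik Skj; rewrite mem_set //; exists k.
  by case: ifP.
Qed.
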